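(* Let $(E,\tau)$ be a locally solid vector lattice. Then $E$ is order $st$-$u_\tau$-continuous if and only if for every sequence $(x_n)$ in $E$, $x_n\downarrow 0$ implies $x_n\xrightarrow{st-u_\tau}0$.
   Context: All vector lattices are real and Archimedean. A locally solid vector lattice $(E,\tau)$ is a vector lattice $E$ with a linear topology $\tau$ having a base $\mathcal N$ of zero neighborhoods consisting of solid sets ($A$ is solid if $x\in A$, $y\in E$, $|y|\le|x|$ imply $y\in A$). $E_+$ denotes the positive cone of $E$. A sequence $(x_n)$ in $E$ is statistically unbounded $\tau$-convergent to $x\in E$, written $x_n\xrightarrow{st-u_\tau}x$, if for every zero neighborhood $U\in\mathcal N$ and every $u\in E_+$, $\lim_{n\to\infty}\frac1n\big|\{k\le n: |x_k-x|\wedge u\notin U\}\big|=0$. $x_n\downarrow 0$ means $(x_n)$ is decreasing with infimum $0$. A sequence $(x_n)$ order converges to $x$, written $x_n\xrightarrow{o}x$, if there is a sequence $(y_m)$ with $y_m\downarrow 0$ such that for every $m$ there is $n_m$ with $|x_n-x|\le y_m$ for all $n\ge n_m$. $E$ is called order $st$-$u_\tau$-continuous if, for every sequence $(x_n)$ in $E$, $x_n\xrightarrow{o}0$ implies $x_n\xrightarrow{st-u_\tau}0$. *)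

(* Defs.v *)
From HB Require Import structures.
From mathcomp Require Import all_boot all_order all_algebra.
From mathcomp Require Import all_classical all_reals all_analysis.

Set Implicit Arguments.
Unset Strict Implicit.
Unset Printing Implicit Defensive.

Import Order.TTheory GRing.Theory Num.Theory.
Import numFieldNormedType.Exports.

Local Open Scope classical_set_scope.
Local Open Scope ring_scope.

(* Hierarchy Builder rejects a new join of Order.Lattice and GRing.Lmodule
   (Num.RealDomain is already below both Order.Lattice and GRing.Zmodule), so
   the fields of the two semilattice mixins are repeated here, and the
   latticeType structure is recovered by the instances below. *)
HB.mixin Record POrderedLmod_isArchiVectorLattice (R : realType) E
    & Num.POrderedZmodule E & GRing.Lmodule R E := {
  vlat_meet : E -> E -> E;
  vlat_join : E -> E -> E;
  vlat_lexI : forall x y z : E, (x <= vlat_meet y z) = (x <= y) && (x <= z);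
  vlat_leUx : forall x y z : E, (vlat_join x y <= z) = (x <= z) && (y <= z);
  vlat_leD2r : forall z x y : E, x <= y -> x + z <= y + z;
  vlat_scale_ge0 : forall (a : R) (x : E), 0 <= a -> 0 <= x -> 0 <= a *: x;
  vlat_archi : forall x y : E, 0 <= x -> (forall n : nat, x *+ n <= y) -> x = 0
}.

#[short(type="archiVectorLatticeType")]
HB.structure Definition ArchiVectorLattice (R : realType) :=
  {E of Num.POrderedZmodule E & GRing.Lmodule R E
      & POrderedLmod_isArchiVectorLattice R E}.

(* The topology is only required to be linear: local solidity is the existence
   of a solid_zero_base, defined below. It need not be Hausdorff or locally
   convex. *)
#[short(type="topArchiVectorLatticeType")]
HB.structure Definition TopArchiVectorLattice (R : realType) :=
  {E of ArchiVectorLattice R E & TopologicalLmodule R E}.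

HB.instance Definition _ (R : realType) (E : archiVectorLatticeType R) :=
  Order.POrder_isMeetSemilattice.Build ring_display E (@vlat_lexI R E).
HB.instance Definition _ (R : realType) (E : archiVectorLatticeType R) :=
  Order.POrder_isJoinSemilattice.Build ring_display E (@vlat_leUx R E).
HB.instance Definition _ (R : realType) (E : topArchiVectorLatticeType R) :=
  Order.Lattice.copy E (E : archiVectorLatticeType R).

Definition vabs (R : realType) (E : archiVectorLatticeType R) (x : E) : E :=
  (x `|` - x)%O.

Definition solid (R : realType) (E : archiVectorLatticeType R) (A : set E) :=
  forall x y : E, A x -> vabs y <= vabs x -> A y.

Definition solid_zero_base (R : realType) (E : topArchiVectorLatticeType R)
    (N : set_system E) :=
  nbhs (0 : E) = filter_from N id /\ (forall U, N U -> solid U).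

(* Sequences are indexed from 0, so the first n terms are those of index k < n;
   the value at n = 0 is irrelevant to the limit. *)
Definition density_zero (R : realType) (A : set nat) :=
  #|[pred k : 'I_n | (k : nat) \in A]|%:R / n%:R @[n --> \oo] --> (0 : R).

Definition st_u_cvg (R : realType) (E : topArchiVectorLatticeType R)
    (N : set_system E) (x : E ^nat) (l : E) :=
  forall (U : set E) (u : E), N U -> 0 <= u ->
    density_zero R [set k | ~ U (vabs (x k - l) `&` u)%O].

Definition decreases_to0 (R : realType) (E : archiVectorLatticeType R)
    (x : E ^nat) :=
  nonincreasing_seq x /\ infimums (range x) 0.

Definition order_cvg (R : realType) (E : archiVectorLatticeType R)
    (x : E ^nat) (l : E) :=
  exists2 y : E ^nat, decreases_to0 y &
    forall m, exists nm, forall n, (nm <= n)%N -> vabs (x n - l) <= y m.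

Definition order_st_u_continuous (R : realType)
    (E : topArchiVectorLatticeType R) (N : set_system E) :=
  forall x : E ^nat, order_cvg x 0 -> st_u_cvg N x 0.

(* Main.v *)
(** If [|x_n| <= y_m] for all [n >= n_m], with [y] decreasing to [0], reindex [y]
    by the largest [m <= n] with [n_m <= n]: this slowed-down copy [z] of [y]
    still decreases to [0] and satisfies [|x_n| <= z_n] for all but finitely
    many [n].  By solidity the exceptional indices of [x] are, up to finitely
    many, exceptional indices of [z]. *)
Require Import Defs.
From HB Require Import structures.
From mathcomp Require Import all_boot all_order all_algebra.
From mathcomp Require Import all_classical all_reals all_analysis.

Set Implicit Arguments.
Unset Strict Implicit.
Unset Printing Implicit Defensive.

Import Order.TTheory GRing.Theory Num.Theory.
Import numFieldNormedType.Exports.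

Local Open Scope classical_set_scope.
Local Open Scope ring_scope.

Section VectorLattice.
Variables (R : realType) (E : archiVectorLatticeType R).
Implicit Types x y : E.

(** Adding [x <= vabs x] and [- x <= vabs x] gives [0 <= vabs x + vabs x]; scaling by [2^-1] halves
    this. *)
Lemma vabs_ge0 x : 0 <= vabs x.
Proof.
have hx : x <= vabs x by rewrite /vabs leUl.
have hNx : - x <= vabs x by rewrite /vabs leUr.
have h2 : 0 <= vabs x + vabs x.
  rewrite -[X in X <= _](addrN x); apply: le_trans (vlat_leD2r _ _ _ hx) _.
  by rewrite ![vabs x + _]addrC; exact: vlat_leD2r.
have -> : vabs x = 2^-1 *: (vabs x + vabs x).
  by rewrite -mulr2n -(scaler_nat 2 (vabs x)) scalerA mulVf ?pnatr_eq0 // scale1r.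
by apply: vlat_scale_ge0 => //; rewrite invr_ge0 ler0n.
Qed.

Lemma vabs_id x : 0 <= x -> vabs x = x.
Proof.
move=> x0; apply/join_idPl; apply: le_trans (x0).
by rewrite -[- x]add0r -[X in _ <= X](addrN x); exact: vlat_leD2r.
Qed.

(** Both meets are nonnegative, so they are their own absolute values and solidity reduces to
    monotonicity of the meet. *)
Lemma solid_meet (A : set E) (u x y : E) : solid A -> 0 <= u -> 0 <= x ->
  x <= y -> A (y `&` u)%O -> A (x `&` u)%O.
Proof.
move=> sA u0 x0 xy Ay; apply: sA Ay _.
by rewrite !vabs_id; [exact: leI2| |]; rewrite lexI u0 ?(le_trans x0 xy) ?x0.
Qed.

Lemma decreases_to0_ge0 (x : E ^nat) n : decreases_to0 x -> 0 <= x n.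
Proof. by case=> _ [+ _]; apply; exists n. Qed.

Lemma decreases_to0_order_cvg (x : E ^nat) :
  decreases_to0 x -> order_cvg x 0.
Proof.
move=> x0; exists x => // m; exists m => n mn.
rewrite subr0 vabs_id; first by case: x0 => + _; exact.
exact: decreases_to0_ge0.
Qed.

(** Every [y m] dominates some [y (p n)], so a lower bound of the reindexed sequence is also one of
    [y]. *)
Lemma decreases_to0_comp (y : E ^nat) (p : nat -> nat) :
    {homo p : m n / (m <= n)%N} -> (forall m, exists n, (m <= p n)%N) ->
  decreases_to0 y -> decreases_to0 (y \o p).
Proof.
move=> p_mono p_unbounded y0; have [y_dec [_ y_inf]] := y0.
split; first by move=> m n mn; apply: y_dec; exact: p_mono.
split=> [_ [n _ <-]|b b_lb]; first exact: decreases_to0_ge0 (p n) y0.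
apply: y_inf => _ [m _ <-]; have [n mpn] := p_unbounded m.
by apply: le_trans (y_dec _ _ mpn); apply: b_lb; exists n.
Qed.

Lemma order_cvg0_dominated (x : E ^nat) : order_cvg x 0 ->
  exists2 z : E ^nat, decreases_to0 z &
    exists n0, forall n, (n0 <= n)%N -> vabs (x n) <= z n.
Proof.
case=> y y0 /choice[N xy].
(* The cutoff [m < n.+1] keeps the maximum finite even if [N] is bounded. [N] need not be
   monotone. *)
pose p n := (\max_(m < n.+1 | N m <= n) m)%N.
have leq_p m n : (m <= n)%N -> (N m <= n)%N -> (m <= p n)%N.
  by rewrite -ltnS => mn Nm; exact: (leq_bigmax_cond (Ordinal mn) Nm).
exists (y \o p).
  apply: decreases_to0_comp y0.
    move=> m n mn; apply/bigmax_leqP => i Ni.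
    by apply: leq_p; [apply: leq_trans mn; rewrite -ltnS|exact: leq_trans mn].
  by move=> m; exists (maxn m (N m)); rewrite leq_p ?leq_maxl ?leq_maxr.
(* From [N 0] on, the index 0 qualifies, so the maximum is attained at some [i] with [N i <= n].
   Earlier, [p n] may be the default 0 of an empty maximum, which bounds nothing. *)
exists (N 0%N) => n N0n; rewrite -[x n]subr0; apply: xy.
have [|i Ni pE] := @eq_bigmax_cond _ [pred m : 'I_n.+1 | (N m <= n)%N] (@nat_of_ord _).
  by apply/card_gt0P; exists ord0.
by rewrite /p pE.
Qed.

End VectorLattice.

(** An index in [A] is below [n0] or in [B], so the density quotient of [A] exceeds that of [B] by
    at most [n0 / n], which tends to 0. *)
Lemma density_zero_sub_eventually (R : realType) (A B : set nat) (n0 : nat) :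
    (forall k, (n0 <= k)%N -> A k -> B k) ->
  density_zero R B -> density_zero R A.
Proof.
move=> AB B0; pose b n := #|[pred k : 'I_n | (k : nat) \in B]|%:R / n%:R : R.
apply: (@squeeze_cvgr _ _ _ _ (fun=> 0) (fun n => n0%:R / n%:R + b n)).
- apply: nearW => n; rewrite divr_ge0 ?ler0n //= /b -mulrDl -natrD.
  rewrite ler_wpM2r ?invr_ge0 ?ler0n // ler_nat.
  have card_lt : (#|[pred k : 'I_n | (k < n0)%N]| <= n0)%N.
    rewrite cardE -(size_map val) -[leqRHS](size_iota 0); apply: uniq_leq_size.
      by rewrite (map_inj_uniq val_inj) enum_uniq.
    by move=> _ /mapP[k + ->]; rewrite mem_enum mem_iota.
  (* The two cardinals sum to those of the union and the intersection; the latter is dropped. *)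
  apply: leq_trans (leq_add card_lt (leqnn _)); rewrite -cardUI.
  apply: leq_trans (leq_addr _ _); apply/subset_leq_card/fintype.subsetP => k.
  rewrite !unfold_in /= => Ak; case: ltnP => //= n0k.
  by apply/mem_set/(AB _ n0k)/set_mem.
- exact: cvg_cst.
- rewrite -[X in _ --> X]addr0; apply: cvgD B0.
  rewrite -(mulr0 n0%:R); apply: cvgM; first exact: cvg_cst.
  apply/gtr0_cvgV0; last exact: cvgr_idn.
  by near=> n; rewrite ltr0n; near: n; exists 1%N.
Unshelve. all: by end_near. Qed.

Theorem theorem2p10 (R : realType) (E : topArchiVectorLatticeType R)
    (N : set_system E) (hN : solid_zero_base N) :
  order_st_u_continuous N <->
  (forall x : nat -> E, decreases_to0 x -> st_u_cvg N x (0%R : E)).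
Proof.
split=> [cont x /decreases_to0_order_cvg|dec x]; first exact: cont.
case/order_cvg0_dominated => z z0 [n0 xz] U u NU u0.
apply: (@density_zero_sub_eventually _ _ _ n0) (dec z z0 U u NU u0) => k n0k /=.
rewrite !subr0 (vabs_id (decreases_to0_ge0 k z0)); apply: contra_not.
exact: (solid_meet (hN.2 U NU) u0 (vabs_ge0 (x k)) (xz k n0k)).
Qed.
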